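(* $\mathscr{G}(1,1)=\{S_{1,1}\}$ and $\mathscr{G}(1,2)=\{S_{2,2}\}$ (up to isomorphism).
   Context: Graphs are finite, simple and undirected; eigenvalues are those of the adjacency matrix. An eigenvalue of $G$ is main if it has an eigenvector with nonzero entry sum. For integers $a,b$, $\mathscr{G}(a,b)$ is the set of connected graphs with exactly two main eigenvalues satisfying $\sum_{u\in N(v)}d(u)=a\,d(v)+b$ for every vertex $v$. For $n_1,n_2\ge 1$, the double star $S_{n_1,n_2}$ is the tree obtained from an edge $uv$ by attaching $n_1$ pendant vertices to $u$ and $n_2$ pendant vertices to $v$. *)

(* Defs.v *)
From mathcomp Require Import all_boot all_order all_algebra.
From mathcomp Require Import reals.

Set Implicit Arguments.
Unset Strict Implicit.
Unset Printing Implicit Defensive.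

Import GRing.Theory.
Local Open Scope ring_scope.

Record sgraph := SGraph {
  vertex :> finType;
  adj : rel vertex;
  adj_sym : symmetric adj;
  adj_irrefl : irreflexive adj }.

Definition isomorphic (G H : sgraph) : Prop :=
  exists2 f : G -> H, bijective f & {mono f : x y / adj x y}.

Definition neighbours (G : sgraph) (x : G) : {set G} := [set y | adj x y].

Definition degree (G : sgraph) (x : G) : nat := #|neighbours x|.

Definition connected (G : sgraph) : Prop :=
  (0 < #|G|)%N /\ forall x y : G, connect (@adj G) x y.

Definition adjmx (R : nzRingType) (G : sgraph) : 'M[R]_#|G| :=
  \matrix_(i, j) (adj (enum_val i) (enum_val j))%:R.

(* As in mxalgebra's [eigenvalue], eigenvectors are row vectors; [adjmx] is
   symmetric, so this makes no difference. *)
Definition main_eigenvalue (R : fieldType) (G : sgraph) (mu : R) : Prop :=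
  eigenvalue (adjmx R G) mu /\
  exists2 v : 'rV[R]_#|G|, (v <= eigenspace (adjmx R G) mu)%MS
                         & \sum_i v 0 i != 0.

Definition two_main_eigenvalues (R : fieldType) (G : sgraph) : Prop :=
  exists mu1 mu2 : R, mu1 <> mu2 /\
    forall mu : R, main_eigenvalue G mu <-> mu = mu1 \/ mu = mu2.

Definition in_scrG (R : realType) (a b : int) (G : sgraph) : Prop :=
  [/\ connected G,
      two_main_eigenvalues R G
    & forall x : G,
        (\sum_(y in neighbours x) degree y)%N%:Z = a * (degree x)%:Z + b].

(* [inl true] and [inl false] are the centres u and v; [inr (inl i)] are the
   pendant vertices at u, [inr (inr j)] those at v. *)
Definition double_star_vertex (n1 n2 : nat) : finType :=
  (bool + ('I_n1 + 'I_n2))%type.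

Definition double_star_adj (n1 n2 : nat) : rel (double_star_vertex n1 n2) :=
  fun x y => match x, y with
  | inl c, inl c' => c != c'
  | inl c, inr (inl _) | inr (inl _), inl c => c
  | inl c, inr (inr _) | inr (inr _), inl c => ~~ c
  | inr _, inr _ => false
  end.

Lemma double_star_sym n1 n2 : symmetric (@double_star_adj n1 n2).
Proof. by move=> [c|[i|i]] [c'|[j|j]] //=; rewrite eq_sym. Qed.

Lemma double_star_irrefl n1 n2 : irreflexive (@double_star_adj n1 n2).
Proof. by move=> [c|[i|i]] //=; rewrite eqxx. Qed.

Definition double_star (n1 n2 : nat) : sgraph :=
  SGraph (@double_star_sym n1 n2) (@double_star_irrefl n1 n2).

(* Main.v *)
Require Import Defs.
From mathcomp Require Import all_boot all_order all_algebra.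
From mathcomp Require Import reals.
From mathcomp Require Import ring lra zify.

(** With a = 1 the defining equation says that [degree y - 1] sums to b over the
    neighbours y of every vertex. If no degree lies strictly between 1 and
    b + 1, then every vertex has exactly one non-pendant neighbour, of degree
    b + 1, and connectedness leaves only the double star. For b = 2 the other
    possibility is a vertex of degree 2; this degree propagates to the
    neighbours, so the graph is 2-regular and has a single main eigenvalue.
    Conversely, if w is an eigenvector for mu with nonzero entry sum, pairing
    w with the degree vector gives mu^2 = mu + b, and both roots occur, with
    eigenvector degree + mu - 1. *)

Set Implicit Arguments.
Unset Strict Implicit.
Unset Printing Implicit Defensive.

Import Order.TTheory GRing.Theory Num.Theory.
Local Open Scope ring_scope.

(** * Neighbourhoods, degrees and induction along paths *)

(** Serves to label the pendant neighbours of a centre by ['I_n], as in the double star. *)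
Lemma card_enumeration (T : finType) (A : {set T}) (n : nat) :
  #|A| = n -> exists2 g : 'I_n -> T, injective g
    & forall y, y \in A <-> exists i, y = g i.
Proof.
move=> <-; exists enum_val => [|y]; first exact: enum_val_inj.
split=> [yA|[i ->]]; last exact: enum_valP.
by exists (enum_rank_in yA y); rewrite enum_rankK_in.
Qed.

Lemma neighbours_sym (G : sgraph) (x y : G) :
  (y \in neighbours x) = (x \in neighbours y).
Proof. by rewrite !inE adj_sym. Qed.

Lemma neighbour_neq (G : sgraph) (x y : G) : adj x y -> x != y.
Proof. by apply: contraTneq => ->; rewrite adj_irrefl. Qed.

Lemma degree_gt0 (G : sgraph) (x y : G) : adj x y -> (0 < degree x)%N.
Proof. by move=> xy; rewrite card_gt0; apply/set0Pn; exists y; rewrite inE. Qed.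

Lemma pendant_neighbour_unique (G : sgraph) (x y z : G) :
  (degree x <= 1)%N -> adj x y -> adj x z -> y = z.
Proof.
by move=> /card_le1_eqP dx xy xz; apply: dx; rewrite inE.
Qed.

Lemma connected_ind (G : sgraph) (P : pred G) (x : G) : connected G -> P x ->
  (forall y z, P y -> adj y z -> P z) -> forall y, P y.
Proof.
move=> [_ conn] Px Pstep y.
have /connectP[p] := conn x y.
elim: p x Px => [|z p IHp] x Px /=; first by move=> _ ->.
by case/andP=> xz; apply: IHp; apply: Pstep xz.
Qed.

(** * Main eigenvalues through functions on the vertices *)

(** The adjacency operator is self-adjoint: both sides sum the same terms over ordered pairs of
    adjacent vertices. *)
Lemma sum_neighbours_adjoint (R : comNzRingType) (G : sgraph) (h w : G -> R) :
  \sum_x h x * \sum_(y in neighbours x) w y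
  = \sum_x w x * \sum_(y in neighbours x) h y.
Proof.
under eq_bigr do rewrite mulr_sumr.
under [RHS]eq_bigr do rewrite mulr_sumr.
rewrite (exchange_big_dep predT) //=.
apply: eq_bigr => x _; apply: eq_big => [y|y _]; last by rewrite mulrC.
by rewrite neighbours_sym.
Qed.

Lemma sum_neighbours1 (R : nzRingType) (G : sgraph) (x : G) :
  \sum_(y in neighbours x) (1 : R) = (degree x)%:R.
Proof. by rewrite sumr_const. Qed.

(** Replaces row vectors over ordinals by functions on vertices, so that later arguments avoid
    matrices. A nonzero entry sum already makes [w] nonzero. *)
Lemma main_eigenvalueP (R : fieldType) (G : sgraph) (mu : R) :
  main_eigenvalue G mu <->
  exists2 w : G -> R, forall x, \sum_(y in neighbours x) w y = mu * w x
                    & \sum_x w x != 0.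
Proof.
have sum_rank (F : 'I_#|G| -> R) : \sum_i F i = \sum_x F (enum_rank x).
  by apply: reindex; apply: onW_bij; apply: enum_rank_bij.
have adjmxE (v : 'rV[R]_#|G|) x : (v *m adjmx R G) 0 (enum_rank x)
    = \sum_(y in neighbours x) v 0 (enum_rank y).
  rewrite mxE sum_rank [RHS]big_mkcond /=; apply: eq_bigr => y _.
  rewrite mxE !enum_rankK inE adj_sym.
  by case: adj; rewrite ?mulr1 ?mulr0.
split=> [[_ [v /eigenspaceP vA v0]]|[w wA w0]].
  exists (fun x => v 0 (enum_rank x)) => [x|]; last by rewrite -sum_rank.
  by rewrite -adjmxE vA mxE.
pose v : 'rV[R]_#|G| := \row_i w (enum_val i).
have vE x : v 0 (enum_rank x) = w x by rewrite mxE enum_rankK.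
have vs : \sum_i v 0 i != 0 by rewrite sum_rank; under eq_bigr do rewrite vE.
have vA : v *m adjmx R G = mu *: v.
  apply/rowP => i; rewrite -[i]enum_valK adjmxE mxE vE -wA.
  by apply: eq_bigr => y _; rewrite vE.
split; last by exists v => //; apply/eigenspaceP.
apply/eigenvalueP; exists v => //; apply: contraNneq vs => ->.
by rewrite big1 // => i _; rewrite mxE.
Qed.

(** Pairing [w] with the constant 1 gives [mu] times its sum on one side and [k] times its sum on
    the other. *)
Lemma main_eigenvalue_regular (R : fieldType) (G : sgraph) (k : nat) (mu : R) :
  (forall x : G, degree x = k) -> main_eigenvalue G mu -> mu = k%:R.
Proof.
move=> reg /main_eigenvalueP[w wA w0].
have := sum_neighbours_adjoint (fun=> 1) w.
under eq_bigr do rewrite wA mul1r.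
under [RHS]eq_bigr do rewrite sum_neighbours1 reg.
by rewrite -mulr_sumr -mulr_suml mulrC => /(mulfI w0).
Qed.

Lemma main_eigenvalue_quadratic (R : fieldType) (G : sgraph) (a b : int) (mu : R) :
  (forall x : G, (\sum_(y in neighbours x) degree y)%N%:Z
                 = a * (degree x)%:Z + b) ->
  main_eigenvalue G mu -> mu ^+ 2 = a%:~R * mu + b%:~R.
Proof.
move=> Gab /main_eigenvalueP[w wA w0].
have wd : \sum_x w x * (degree x)%:R = mu * \sum_x w x.
  have := sum_neighbours_adjoint (fun=> 1) w.
  under eq_bigr do rewrite wA mul1r.
  under [RHS]eq_bigr do rewrite sum_neighbours1.
  by rewrite -mulr_sumr.
have := sum_neighbours_adjoint (fun x => (degree x)%:R) w.
have dE (x : G) : \sum_(y in neighbours x) (degree y)%:R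
    = a%:~R * (degree x)%:R + b%:~R :> R.
  by rewrite -natr_sum pmulrn Gab intrD intrM -pmulrn.
under eq_bigr do rewrite wA mulrCA mulrC.
under [RHS]eq_bigr do rewrite dE mulrDr mulrCA.
under eq_bigr do rewrite [_ * w _]mulrC.
rewrite -mulr_suml big_split /= -mulr_sumr -mulr_suml wd => E.
by apply: (mulfI w0); rewrite -[LHS]/(_ * (mu * mu)); ring: E.
Qed.

(** * Invariance under isomorphism *)

Section Isomorphism.
Variables (G H : sgraph) (f : G -> H).
Hypotheses (f_bij : bijective f) (f_adj : {mono f : x y / adj x y}).

Lemma iso_sum_neighbours (V : nmodType) (F : H -> V) (x : G) :
  \sum_(y in neighbours (f x)) F y = \sum_(y in neighbours x) F (f y).
Proof.
rewrite (reindex f) /=; last exact: onW_bij.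
by apply: eq_bigl => y; rewrite !inE f_adj.
Qed.

Lemma iso_degree (x : G) : degree (f x) = degree x.
Proof.
by rewrite /degree -!sum1_card; apply: (iso_sum_neighbours (V := nat) (fun=> 1%N)).
Qed.

Lemma iso_connected : connected H -> connected G.
Proof.
move=> connH; have [g gK fK] := f_bij.
split=> [|x y]; first by rewrite (bij_eq_card f_bij); case: connH.
rewrite -[y]gK.
apply: (@connected_ind _ (fun z => connect (@adj G) x (g z)) (f x) connH).
  by rewrite gK.
move=> z t xz zt; apply: connect_trans xz (connect1 _).
by rewrite -f_adj !fK.
Qed.

Lemma iso_main_eigenvalue (R : fieldType) (mu : R) :
  main_eigenvalue H mu <-> main_eigenvalue G mu.
Proof.
have [g gK fK] := f_bij.
split=> /main_eigenvalueP[w wA w0]; apply/main_eigenvalueP.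
  exists (w \o f) => [x|]; first by rewrite -iso_sum_neighbours wA.
  by rewrite -(reindex f (P := predT)) //; apply: onW_bij.
exists (w \o g) => [x|].
  rewrite -[x]fK iso_sum_neighbours /= gK -wA.
  by apply: eq_bigr => y _; rewrite gK.
by rewrite -(reindex g (P := predT)) //; apply: onW_bij; exists f.
Qed.

Lemma iso_in_scrG (R : realType) (a b : int) : in_scrG R a b H -> in_scrG R a b G.
Proof.
move=> [connH [mu1 [mu2 [mu12 muP]]] sumH]; split; first exact: iso_connected.
  by exists mu1, mu2; split=> // mu; rewrite -iso_main_eigenvalue.
move=> x; rewrite -iso_degree -sumH (iso_sum_neighbours (V := nat)).
by under [in RHS]eq_bigr do rewrite iso_degree.
Qed.

End Isomorphism.

Lemma isomorphic_sym (G H : sgraph) : isomorphic G H -> isomorphic H G.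
Proof.
move=> [f [g gK fK] f_adj]; exists g; first by exists f.
by move=> x y; rewrite -f_adj !fK.
Qed.

(** * Balanced double stars belong to the class *)

Lemma double_star_sum_neighbours (V : nmodType) (n1 n2 : nat)
    (F : double_star n1 n2 -> V) (x : double_star n1 n2) :
  \sum_(y in neighbours x) F y =
  match x with
  | inl true => F (inl false) + \sum_i F (inr (inl i))
  | inl false => F (inl true) + \sum_i F (inr (inr i))
  | inr (inl _) => F (inl true)
  | inr (inr _) => F (inl false)
  end.
Proof.
rewrite big_mkcond big_sumType big_sumType big_bool /=.
under eq_bigr do rewrite inE.
under [X in _ + (_ + X)]eq_bigr do rewrite inE.
rewrite !inE; case: x => [[]|[i|i]] /=;
  by rewrite ?big1_eq ?add0r ?addr0.
Qed.

Lemma double_star_degree (n1 n2 : nat) (x : double_star n1 n2) :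
  degree x = match x with inl true => n1.+1 | inl false => n2.+1 | _ => 1%N end.
Proof.
rewrite /degree -sum1_card (double_star_sum_neighbours (V := nat)).
by case: x => [[]|[]] //; rewrite sum1_card card_ord.
Qed.

Lemma double_star_connected (n1 n2 : nat) : connected (double_star n1 n2).
Proof.
split=> [|x y]; first by apply/card_gt0P; exists (inl true).
have centre z : connect (@adj (double_star n1 n2)) (inl true) z.
  have uv : connect (@adj (double_star n1 n2)) (inl true) (inl false).
    exact: connect1.
  case: z => [[]|[i|i]] //; first exact: connect1.
  by apply: connect_trans uv (connect1 _).
apply: connect_trans (centre y).
by rewrite (sym_connect_sym (@adj_sym _)).
Qed.

Lemma double_star_scrG (R : realType) (n : nat) :
  (0 < n)%N -> in_scrG R 1 n%:Z (double_star n n).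
Proof.
move=> n0.
have sumS (x : double_star n n) :
    (\sum_(y in neighbours x) degree y)%N%:Z = 1 * (degree x)%:Z + n%:Z.
  rewrite (double_star_sum_neighbours (V := nat)).
  case: x => [[]|[i|i]]; rewrite !double_star_degree ?mul1r //;
    by under eq_bigr do rewrite double_star_degree; rewrite sum1_card card_ord; lia.
split=> //; first exact: double_star_connected.
(* The discriminant of [mu ^+ 2 - mu - n] is [1 + 4 * n]. *)
pose s : R := Num.sqrt (1 + 4 * n%:R).
have nR0 : 0 < n%:R :> R by rewrite ltr0n.
have s2 : s ^+ 2 = 1 + 4 * n%:R by rewrite sqr_sqrtr; lra.
have s0 : 0 < s by rewrite sqrtr_gt0; lra.
exists ((1 + s) / 2), ((1 - s) / 2); split=> [|mu]; first by lra.
suff -> : main_eigenvalue (double_star n n) mu <-> mu ^+ 2 = mu + n%:R.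
  split=> [muE|[] ->]; [|by field: s2|by field: s2].
  have /eqP : (mu - (1 + s) / 2) * (mu - (1 - s) / 2) = 0 by field: muE s2.
  by rewrite mulf_eq0 !subr_eq0 => /orP[]/eqP; auto.
split=> [/(main_eigenvalue_quadratic sumS)|muE]; first by rewrite mul1r.
(* With d the degree function, the operator sends d to d + n and 1 to d. Hence d + (mu - 1) goes to
   mu d + n, and n = mu (mu - 1). *)
apply/main_eigenvalueP; exists (fun x => (degree x)%:R + (mu - 1)) => [x|].
  rewrite big_split /= -natr_sum pmulrn sumS sumr_const -[#|_|]/(degree x).
  rewrite mul1r -mulr_natr; ring: muE.
have -> : \sum_(x : double_star n n) ((degree x)%:R + (mu - 1))
    = 2 * (n%:R + (n%:R + 1) * mu) :> R.
  rewrite big_sumType big_sumType big_bool /=.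
  under eq_bigr do rewrite double_star_degree.
  under [X in _ + (_ + X)]eq_bigr do rewrite double_star_degree.
  rewrite !double_star_degree !sumr_const !card_ord; ring.
apply/eqP => sum0.
have smu : (n%:R + 1) * mu = - n%:R by lra.
(* The quadratic equation times [(n + 1) ^+ 2]; substituting [- n] for [(n + 1) * mu] collapses it
   to [n ^+ 3 = 0]. *)
have : ((n%:R + 1) * mu) ^+ 2
    = (n%:R + 1) * ((n%:R + 1) * mu) + (n%:R + 1) ^+ 2 * n%:R by ring: muE.
rewrite smu => n3.
have : 0 < n%:R ^+ 3 :> R by rewrite exprn_gt0.
lra.
Qed.

(** * Recognising the double star from its local structure *)

Lemma double_star_characterization (G : sgraph) (b : nat) :
  connected G -> (0 < b)%N ->
  (forall x : G, exists y, [/\ adj x y, degree y = b.+1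
     & forall z, adj x z -> z != y -> degree z = 1%N]) ->
  isomorphic G (double_star b b).
Proof.
move=> connG b0 nbr.
have [x0 _] : exists x0 : G, x0 \in G by apply/card_gt0P; case: connG.
(* The distinguished neighbour of any vertex can serve as a centre; its own distinguished neighbour
   is the other centre. *)
have [u [_ du _]] := nbr x0.
have [v [uv dv leaf_u]] := nbr u.
have vu : adj v u by rewrite adj_sym.
have leaf_v z : adj v z -> z != u -> degree z = 1%N.
  have [y [vy dy leafy]] := nbr v.
  (* Otherwise [u] would be a pendant neighbour of [v], against its degree [b.+1 > 1]. *)
  suff -> : u = y by apply: leafy.
  by apply/eqP; apply: contraT => /(leafy u vu); lia.
have pendants (x y : G) : adj x y -> degree x = b.+1 -> #|neighbours x :\ y| = b.
  by move=> xy; rewrite /degree (cardsD1 y) inE xy => -[].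
have [g1 g1_inj g1P] := card_enumeration (pendants _ _ uv du).
have [g2 g2_inj g2P] := card_enumeration (pendants _ _ vu dv).
have g1E i : [/\ adj u (g1 i), g1 i != v & degree (g1 i) = 1%N].
  have /setD1P[nv] : g1 i \in neighbours u :\ v by apply/g1P; exists i.
  by rewrite inE => ug; split=> //; apply: leaf_u.
have g2E i : [/\ adj v (g2 i), g2 i != u & degree (g2 i) = 1%N].
  have /setD1P[nv] : g2 i \in neighbours v :\ u by apply/g2P; exists i.
  by rewrite inE => ug; split=> //; apply: leaf_v.
have only (x y z : G) : degree x = 1%N -> adj y x -> adj x z -> z = y.
  move=> dx yx xz; apply: (pendant_neighbour_unique _ xz); first by rewrite dx.
  by rewrite adj_sym.
have g1adj i z : adj (g1 i) z = (z == u).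
  have [ug _ dg] := g1E i; apply/idP/eqP => [|->]; last by rewrite adj_sym.
  exact: only.
have g2adj i z : adj (g2 i) z = (z == v).
  have [ug _ dg] := g2E i; apply/idP/eqP => [|->]; last by rewrite adj_sym.
  exact: only.
have uDv := neighbour_neq uv.
have g1u i : g1 i != u by have [/neighbour_neq] := g1E i; rewrite eq_sym.
have g2v i : g2 i != v by have [/neighbour_neq] := g2E i; rewrite eq_sym.
have g1v i : g1 i != v by have [] := g1E i.
have g2u i : g2 i != u by have [] := g2E i.
(* The only neighbour of [g1 i] is [u], that of [g2 j] is [v]. *)
have g12 i j : g1 i != g2 j.
  by apply/eqP => E; move: (g1adj i u); rewrite E g2adj eqxx (negPf uDv).
pose h (x : double_star b b) : G :=
  match x with
  | inl c => if c then u else v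
  | inr (inl i) => g1 i
  | inr (inr i) => g2 i
  end.
have h_inj : injective h.
  have sep := (negPf uDv, fun i => negPf (g1u i), fun i => negPf (g2u i),
    fun i => negPf (g1v i), fun i => negPf (g2v i), fun i j => negPf (g12 i j)).
  move=> [[]|[i|i]] [[]|[j|j]] //= /eqP;
    try by [rewrite sep | rewrite eq_sym sep].
  - by move=> /eqP/g1_inj ->.
  - by move=> /eqP/g2_inj ->.
have h_adj : {mono h : x y / adj x y}.
  have vDu : v != u by rewrite eq_sym.
  by move=> [[]|[i|i]] [[]|[j|j]]; rewrite /= ?adj_irrefl ?uv ?vu //
    ?[adj u _]adj_sym ?[adj v _]adj_sym ?g1adj ?g2adj ?eqxx //; apply: negPf.
(* The image of [h] contains [u] and is closed under adjacency, so connectedness makes it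
   everything. *)
have h_surj y : y \in codom h.
  apply: (@connected_ind _ _ u connG) => [|{}y z /codomP[x ->]].
    exact: (codom_f h (inl true)).
  case: x => [[]|[k|k]] /= yz.
  - have [->|zv] := eqVneq z v; first exact: (codom_f h (inl false)).
    have /g1P[i ->] : z \in neighbours u :\ v by rewrite !inE zv.
    exact: (codom_f h (inr (inl i))).
  - have [->|zu] := eqVneq z u; first exact: (codom_f h (inl true)).
    have /g2P[i ->] : z \in neighbours v :\ u by rewrite !inE zu.
    exact: (codom_f h (inr (inr i))).
  - by move: yz; rewrite g1adj => /eqP->; apply: (codom_f h (inl true)).
  - by move: yz; rewrite g2adj => /eqP->; apply: (codom_f h (inl false)).
apply: isomorphic_sym; exists h => //.
by exists (fun y => iinv (h_surj y)) => x; [apply: iinv_f | apply: f_iinv].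
Qed.

(** * Degrees in the class for a = 1 *)

Lemma scrG1_sum_pred_degree (R : realType) (G : sgraph) (b : nat) (x : G) :
  in_scrG R 1 b%:Z G -> (\sum_(y in neighbours x) (degree y).-1 = b)%N.
Proof.
move=> [_ _ /(_ x)]; rewrite mul1r -PoszD => -[].
rewrite (eq_bigr (fun y => (degree y).-1 + 1)%N) => [|y].
  by rewrite big_split /= sum1_card -/(degree x) addnC => /addnI.
(* A neighbour of [x] has positive degree, so the truncated predecessor loses nothing. *)
by rewrite inE adj_sym => /degree_gt0; case: degree => // d _; rewrite addn1.
Qed.

(** Since [b] is positive, some neighbour is not pendant. By the gap it contributes at least [b],
    the whole sum, so its degree is [b.+1] and the other neighbours are pendant. *)
Lemma scrG1_double_star (R : realType) (G : sgraph) (b : nat) :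
  (0 < b)%N -> in_scrG R 1 b%:Z G ->
  (forall x : G, (degree x <= 1)%N || (b < degree x)%N) ->
  isomorphic G (double_star b b).
Proof.
move=> b0 GG gap.
have sumG x := scrG1_sum_pred_degree x GG.
apply: double_star_characterization => // [|x]; first by case: GG.
have [y xy dy] : exists2 y, adj x y & (b < degree y)%N.
  apply/exists_inP; apply: contraTT (b0) => /exists_inPn small.
  rewrite -(sumG x) big1 // => y; rewrite inE => xy.
  by have := gap y; have := small y xy; lia.
have := sumG x; rewrite (bigD1 y) ?inE //= => sum_x.
exists y; split=> // [|z xz zy]; first lia.
have /eqP : (\sum_(i in neighbours x | i != y) (degree i).-1 = 0)%N by lia.
rewrite sum_nat_eq0 => /forall_inP/(_ z).
rewrite inE xz zy => /(_ isT).
have : (0 < degree z)%N by apply: (@degree_gt0 _ _ x); rewrite adj_sym.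
lia.
Qed.

Lemma scrG12_degree_neq2 (R : realType) (G : sgraph) (x : G) :
  in_scrG R 1 2 G -> degree x != 2.
Proof.
move=> GG; have sumG (y : G) : (\sum_(z in neighbours y) (degree z).-1 = 2)%N.
  exact: scrG1_sum_pred_degree GG.
have [connG [mu1 [mu2 [mu12 muP]]] _] := GG.
apply/eqP => dx.
(* A 2-regular graph has 2 as its only possible main eigenvalue, contradicting [mu1 <> mu2]. *)
suff reg (y : G) : degree y = 2.
  apply: mu12; rewrite (main_eigenvalue_regular reg (mu := mu1)).
    by rewrite (main_eigenvalue_regular reg (mu := mu2)) // muP; right.
  by rewrite muP; left.
apply/eqP; apply: (@connected_ind _ (fun y => degree y == 2) x connG).
  by rewrite dx.
move=> {y x dx} x z /eqP dx xz.
(* If [t] were pendant, its sum would consist of the single term [(degree x).-1 = 1] instead of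
   2. *)
have nonpendant (t : G) : adj x t -> (1 <= (degree t).-1)%N.
  move=> xt; have tx : adj t x by rewrite adj_sym.
  suff : degree t != 1%N by have := degree_gt0 tx; lia.
  apply/eqP => dt; have := sumG t.
  rewrite (big_pred1 x) ?dx // => s; rewrite inE.
  apply/idP/eqP => [ts|->] //.
  by apply: (pendant_neighbour_unique _ ts tx); rewrite dt.
have := sumG x; have := dx; rewrite /degree -sum1_card -/(degree _).
rewrite (bigD1 z) ?inE //= [in X in _ -> X](bigD1 z) ?inE //=.
(* Here [s1 = 1] counts the neighbours of [x] other than [z], so [s2] is at least 1. As
   [(degree z).-1 + s2 = 2] with both terms positive, [degree z] is 2. *)
set s1 := (\sum_(_ in _ | _) 1)%N; set s2 := (\sum_(_ in _ | _) _)%N.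
have : (s1 <= s2)%N.
  by apply: leq_sum => t /andP[]; rewrite inE => /nonpendant.
by have := nonpendant z xz; rewrite -/(degree z); lia.
Qed.

Theorem theorem4p4 (R : realType) :
  (forall G : sgraph,
     in_scrG R 1%R 1%R G <-> isomorphic G (double_star 1 1)) /\
  (forall G : sgraph,
     in_scrG R 1%R 2%R G <-> isomorphic G (double_star 2 2)).
Proof.
split=> G; split=> [GG|[f f_bij f_adj]].
(* For b = 1 no integer lies strictly between 1 and b + 1. *)
- by apply: (scrG1_double_star _ GG) => // x; case: leqP.
- exact: (iso_in_scrG f_bij f_adj (double_star_scrG R (n := 1) isT)).
(* For b = 2 the only degree to exclude is 2. *)
- apply: (scrG1_double_star _ GG) => // x.
  by have := scrG12_degree_neq2 x GG; lia.
- exact: (iso_in_scrG f_bij f_adj (double_star_scrG R (n := 2) isT)).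
Qed.
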